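(* Let $I\subset(0,\infty)$ be an interval, let $f:I\to\mathbb{R}$ be differentiable on $I^{\circ}$, and let $a,b\in I$ with $a<b$, where $f'$ exists at every point of $[a,b]$ (one-sided derivative at $a$ or $b$ if that point is an endpoint of $I$), and $f'\in L[a,b]$. Let $q\ge 1$ and suppose $|f'|^q$ is harmonically convex on $[a,b]$. Then for every $\lambda\in[0,1]$ $$\left|(1-\lambda) f\left(\frac{2ab}{a+b}\right)+\lambda\,\frac{f(a)+f(b)}{2}-\frac{ab}{b-a}\int_a^b\frac{f(x)}{x^2}\,dx\right|$$ $$\le\frac{ab(b-a)}{2}\Big\{C_1(\lambda;a,b)^{1-\frac1q}\big[C_2(\lambda;a,b)|f'(a)|^q+C_3(\lambda;a,b)|f'(b)|^q\big]^{\frac1q}$$ $$\qquad+C_1(\lambda;b,a)^{1-\frac1q}\big[C_3(\lambda;b,a)|f'(a)|^q+C_2(\lambda;b,a)|f'(b)|^q\big]^{\frac1q}\Big\},$$ where, for $u,\vartheta>0$ with $u\ne\vartheta$, $$C_1(\lambda;u,\vartheta)=\frac{1}{(\vartheta-u)^2}\left[-4+\frac{[\lambda(\vartheta-u)+2u](3u+\vartheta)}{u(u+\vartheta)}+2\ln\left(\frac{2u(u+\vartheta)}{(2u+\lambda(\vartheta-u))^2}\right)\right],$$ $$C_2(\lambda;u,\vartheta)=\frac{1}{(\vartheta-u)^3}\left\{[\lambda(\vartheta-u)+4u]\ln\left(\frac{[\lambda(\vartheta-u)+2u]^2}{2u(u+\vartheta)}\right)-\frac{[\lambda(\vartheta-u)+2u](5u+3\vartheta)}{u+\vartheta}+7u+\vartheta\right\},$$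 $$C_3(\lambda;u,\vartheta)=C_1(\lambda;u,\vartheta)-C_2(\lambda;u,\vartheta).$$
   Context: A function $g:J\to\mathbb{R}$ on an interval $J\subset\mathbb{R}\setminus\{0\}$ is harmonically convex if $g\left(\frac{xy}{tx+(1-t)y}\right)\le t\,g(y)+(1-t)\,g(x)$ for all $x,y\in J$ and $t\in[0,1]$. $L[a,b]$ denotes the Lebesgue integrable functions on $[a,b]$. *)

(* Defs.v *)
From HB Require Import structures.
From mathcomp Require Import all_boot all_order all_algebra.
From mathcomp Require Import all_classical all_reals all_analysis.
Import Order.TTheory GRing.Theory Num.Theory.
Import numFieldNormedType.Exports.

Set Implicit Arguments.
Unset Strict Implicit.
Unset Printing Implicit Defensive.

Local Open Scope classical_set_scope.
Local Open Scope ring_scope.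

Section Defs.
Context {R : realType}.

(* A function on an interval is represented by a total function R -> R whose
   values outside the interval are irrelevant. *)
Definition harmonically_convex (J : set R) (g : R -> R) : Prop :=
  [/\ is_interval J, ~ J 0 &
      forall x y t : R, J x -> J y -> 0 <= t <= 1 ->
        g (x * y / (t * x + (1 - t) * y)) <= t * g y + (1 - t) * g x].

(* The library's [derivable] and [f^`()] need f on a whole neighbourhood of x.
   Here the difference quotient is restricted to J: at an interior point of J
   this is the ordinary derivative, at an endpoint of J belonging to J it is
   the one-sided derivative. *)
Definition derivable_rel (J : set R) (f : R -> R) (x : R) : Prop :=
  cvg ((fun y => (f y - f x) / (y - x)) @ within J x^').

Definition derive_rel (J : set R) (f : R -> R) (x : R) : R :=
  lim ((fun y => (f y - f x) / (y - x)) @ within J x^').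

Definition C1 (lam u v : R) : R :=
  1 / (v - u) ^+ 2 *
  (- 4 + (lam * (v - u) + 2 * u) * (3 * u + v) / (u * (u + v))
   + 2 * ln (2 * u * (u + v) / (2 * u + lam * (v - u)) ^+ 2)).

Definition C2 (lam u v : R) : R :=
  1 / (v - u) ^+ 3 *
  ((lam * (v - u) + 4 * u)
     * ln ((lam * (v - u) + 2 * u) ^+ 2 / (2 * u * (u + v)))
   - (lam * (v - u) + 2 * u) * (5 * u + 3 * v) / (u + v)
   + 7 * u + v).

Definition C3 (lam u v : R) : R := C1 lam u v - C2 lam u v.

End Defs.

(* Main.v *)
Require Import Defs.
From HB Require Import structures.
From mathcomp Require Import all_boot all_order all_algebra.
From mathcomp Require Import all_classical all_reals all_analysis.
From mathcomp Require Import ring lra.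
Import Order.TTheory GRing.Theory Num.Theory.
Import numFieldNormedType.Exports.

Local Open Scope classical_set_scope.
Local Open Scope ring_scope.

(* With x = ab / (tb + (1-t)a), harmonic convexity reads
   |f'(x)|^q <= t |f'(a)|^q + (1-t) |f'(b)|^q, and for every r > 0 the tangent
   form of Young's inequality turns this into a bound |f'(x)| <= c0 + c1 t.
   Under such an affine bound the left-hand side is estimated without
   integrating f': let F be the primitive of f / x^2 and cut [a, b] at the
   harmonic mean H and at the two points where the kernel lam - 2t (resp. its
   mirror image) vanishes. On each piece the functional is an integral of
   (f(e) - f(x)) / x^2 with e one of a, H, b, which the mean value inequality
   compares with the same integral for the explicit primitive G of c0 + c1 t.
   The resulting logarithmic expression is c0 C1 + c1 C2, and minimizing over r
   separately on each half gives the power mean. *)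

(** * Mean value comparison of increments *)

(** Both [G - f] and [G + f] have a nonnegative derivative, hence are nondecreasing. *)
Lemma dominated_increment (R : realType) (f df G dG : R -> R) (a b : R) :
  {within `[a, b], continuous f} -> {within `[a, b], continuous G} ->
  (forall x : R, x \in `]a, b[ -> is_derive x 1 f (df x)) ->
  (forall x : R, x \in `]a, b[ -> is_derive x 1 G (dG x)) ->
  (forall x : R, x \in `]a, b[ -> `|df x| <= dG x) ->
  forall p r, a <= p -> p <= r -> r <= b -> `|f r - f p| <= G r - G p.
Proof.
move=> cf cG df_ dG_ le p r ap pr rb.
have pab : p \in `[a, b] by rewrite in_itv/= ap (le_trans pr).
have rab : r \in `[a, b] by rewrite in_itv/= rb (le_trans ap).
have H1 : (G - f) p <= (G - f) r.
  apply: (@ger0_derive1_le_cc _ (G - f) a b) => //.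
  - move=> x xab; have ? := df_ _ xab; have ? := dG_ _ xab.
    by apply: derivableB; apply: ex_derive.
  - move=> x xab; have ? := df_ _ xab; have ? := dG_ _ xab.
    rewrite derive1E derive_val subr_ge0.
    by rewrite (le_trans (ler_norm _))// le.
  - exact: within_continuousB.
have H2 : (G + f) p <= (G + f) r.
  apply: (@ger0_derive1_le_cc _ (G + f) a b) => //.
  - move=> x xab; have ? := df_ _ xab; have ? := dG_ _ xab.
    by apply: derivableD; apply: ex_derive.
  - move=> x xab; have ? := df_ _ xab; have ? := dG_ _ xab.
    rewrite derive1E derive_val.
    by have := le _ xab; rewrite ler_norml => /andP[h _]; lra.
  - exact: within_continuousD.
move: H1 H2; rewrite !fctE ler_norml => H1 H2.
by apply/andP; split; lra.
Qed.

Lemma is_derive_divr (R : realType) (k x : R) : 0 < x ->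
  is_derive x 1 (fun y : R => k / y) (- (k / x ^+ 2)).
Proof.
move=> x0.
have ? : is_derive x 1 (GRing.inv : R -> R) (- x ^- 2 *: 1).
  by apply: is_deriveV; rewrite gt_eqF.
have -> : (fun y : R => k / y) = k \*: (GRing.inv : R -> R) by [].
by apply: is_derive_eq; rewrite /GRing.scale/= mulr1 mulrN.
Qed.

Lemma is_derive_within (R : realType) (f df : R -> R) (a b : R) :
  (forall x : R, x \in `[a, b] -> is_derive x 1 f (df x)) ->
  {within `[a, b], continuous f}.
Proof.
move=> h; apply: derivable_within_continuous => x xab.
by have ? := h _ xab; apply: ex_derive.
Qed.

Lemma within_sub_itv (R : realType) (f : R -> R) (a b c d : R) :
  a <= c -> d <= b ->
  {within `[a, b], continuous f} -> {within `[c, d], continuous f}.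
Proof.
move=> ac db; apply: continuous_subspaceW.
by apply: subset_itv; rewrite bnd_simp.
Qed.

(** The left-hand side is the increment from [e] to [y] of [F x + f e / x], a primitive of
    [(f x - f e) / x ^+ 2]. The derivative bound gives [|f x - f e| <= |G x - G e|], and
    [dominated_increment] is then applied a second time, to the primitives. *)
Lemma weighted_increment (R : realType) (f df F G dG P : R -> R) (a b : R) :
  0 < a ->
  {within `[a, b], continuous f} -> {within `[a, b], continuous F} ->
  (forall x : R, x \in `]a, b[ -> is_derive x 1 f (df x)) ->
  (forall x : R, x \in `]a, b[ -> is_derive x 1 F (f x / x ^+ 2)) ->
  (forall x : R, 0 < x -> is_derive x 1 G (dG x)) ->
  (forall x : R, 0 < x -> is_derive x 1 P (G x / x ^+ 2)) ->
  (forall x : R, x \in `]a, b[ -> `|df x| <= dG x) ->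
  forall e y, e \in `[a, b] -> y \in `[a, b] ->
  `|F y - F e + f e * (y^-1 - e^-1)| <= P y - P e + G e * (y^-1 - e^-1).
Proof.
move=> a0 cf cF df_ dF_ dG_ dP_ le e y.
rewrite !in_itv/= => /andP[ae eb] /andP[ay yb].
have pos (x : R) : x \in `[a, b] -> 0 < x.
  by rewrite in_itv/= => /andP[ax _]; exact: lt_le_trans ax.
have cG : {within `[a, b], continuous G}.
  by apply: (@is_derive_within _ _ dG) => x /pos; exact: dG_.
have dG' (x : R) : x \in `]a, b[ -> is_derive x 1 G (dG x).
  by move=> xab; apply: dG_; apply: pos; exact: subset_itv_oo_cc xab.
have fG p r := @dominated_increment _ _ _ _ _ _ _ cf cG df_ dG' le p r.
pose Fe (x : R) : R := F x + f e / x.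
pose Pe (x : R) : R := P x + G e / x.
have cFe c d : a <= c -> d <= b -> {within `[c, d], continuous Fe}.
  move=> ac db; apply: within_continuousD.
    exact: (@within_sub_itv _ _ _ _ _ _ ac db cF).
  have dfe (z : R) : z \in `[c, d] ->
      is_derive z 1 (fun y : R => f e / y) (- (f e / z ^+ 2)).
    rewrite in_itv/= => /andP[cz zd]; apply/is_derive_divr/pos.
    by rewrite in_itv/= (le_trans ac)//= (le_trans zd).
  exact: (@is_derive_within R _ _ c d dfe).
have dFe (x : R) : x \in `]a, b[ -> is_derive x 1 Fe ((f x - f e) / x ^+ 2).
  move=> xab; have ? := dF_ _ xab.
  have ? := is_derive_divr _ (f e) _ (pos _ (subset_itv_oo_cc xab)).
  by apply: is_derive_eq; rewrite mulrBl.
have dPe (x : R) : 0 < x -> is_derive x 1 Pe ((G x - G e) / x ^+ 2).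
  move=> x0; have ? := dP_ _ x0; have ? := is_derive_divr _ (G e) x x0.
  by apply: is_derive_eq; rewrite mulrBl.
have dNPe (x : R) : 0 < x -> is_derive x 1 (- Pe) ((G e - G x) / x ^+ 2).
  by move=> x0; have ? := dPe _ x0; apply: is_derive_eq; rewrite -mulNr opprB.
have gt0 c (x : R) : a <= c -> c <= x -> 0 < x.
  by move=> ac cx; rewrite (lt_le_trans a0)// (le_trans ac).
have -> : F y - F e + f e * (y^-1 - e^-1) = Fe y - Fe e by rewrite /Fe; ring.
have -> : P y - P e + G e * (y^-1 - e^-1) = Pe y - Pe e by rewrite /Pe; ring.
have [ey|/ltW ye] := leP e y.
- have cPe : {within `[e, y], continuous Pe}.
    apply: derivable_within_continuous => x; rewrite in_itv/= => /andP[ex _].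
    by have ? := dPe _ (gt0 _ _ ae ex); exact: ex_derive.
  have dFe_ey (x : R) : x \in `]e, y[ ->
      is_derive x 1 Fe ((f x - f e) / x ^+ 2).
    rewrite in_itv/= => /andP[ex xy]; apply: dFe.
    by rewrite in_itv/= (le_lt_trans ae)//= (lt_le_trans xy).
  have dPe_ey (x : R) : x \in `]e, y[ ->
      is_derive x 1 Pe ((G x - G e) / x ^+ 2).
    by rewrite in_itv/= => /andP[/ltW ex _]; apply/dPe/(gt0 e).
  have le_ey (x : R) : x \in `]e, y[ ->
      `|(f x - f e) / x ^+ 2| <= (G x - G e) / x ^+ 2.
    rewrite in_itv/= => /andP[ex xy].
    rewrite normrM normfV (ger0_norm (sqr_ge0 x)).
    rewrite ler_wpM2r ?invr_ge0 ?sqr_ge0//.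
    by apply: fG => //; [exact: ltW|rewrite (le_trans (ltW xy))].
  exact: (dominated_increment _ _ _ _ _ _ _ (cFe _ _ ae yb) cPe
    dFe_ey dPe_ey le_ey e y (lexx _) ey (lexx _)).
(* Left of [e] the derivative [(G x - G e) / x ^+ 2] of [Pe] is nonpositive, so [- Pe] is the
   dominating function. *)
- have cPe : {within `[y, e], continuous (- Pe)}.
    apply: derivable_within_continuous => x; rewrite in_itv/= => /andP[yx _].
    by have ? := dNPe _ (gt0 _ _ ay yx); exact: ex_derive.
  have dFe_ye (x : R) : x \in `]y, e[ ->
      is_derive x 1 Fe ((f x - f e) / x ^+ 2).
    rewrite in_itv/= => /andP[yx xe]; apply: dFe.
    by rewrite in_itv/= (le_lt_trans ay)//= (lt_le_trans xe).
  have dPe_ye (x : R) : x \in `]y, e[ ->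
      is_derive x 1 (- Pe) ((G e - G x) / x ^+ 2).
    by rewrite in_itv/= => /andP[/ltW yx _]; apply/dNPe/(gt0 y).
  have le_ye (x : R) : x \in `]y, e[ ->
      `|(f x - f e) / x ^+ 2| <= (G e - G x) / x ^+ 2.
    rewrite in_itv/= => /andP[yx xe].
    rewrite normrM normfV (ger0_norm (sqr_ge0 x)).
    rewrite ler_wpM2r ?invr_ge0 ?sqr_ge0// distrC.
    by apply: fG => //; [rewrite (le_trans ay)// ltW|exact: ltW].
  have -> : Pe y - Pe e = (- Pe) e - (- Pe) y by rewrite !fctE opprK addrC.
  rewrite distrC.
  exact: (dominated_increment _ _ _ _ _ _ _ (cFe _ _ ay eb) cPe
    dFe_ye dPe_ye le_ye y e (lexx _) ye (lexx _)).
Qed.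

(** * Affine bounds in the weight and the estimate of one half *)

(** The reciprocal of the quotient is the convex combination [t / u + (1 - t) / v]. *)
Lemma weighted_harmonic_mean_itv (R : realType) (a b u v t : R) :
  0 < u -> 0 < v -> u \in `[a, b] -> v \in `[a, b] -> 0 <= t <= 1 ->
  u * v / (u + t * (v - u)) \in `[a, b].
Proof.
move=> u0 v0; rewrite !in_itv/= => /andP[au ub] /andP[av vb] /andP[t0 t1].
have z0 : 0 < u + t * (v - u).
  rewrite (_ : _ + _ = (1 - t) * u + t * v); last by ring.
  have [->|tn1] := eqVneq t 1; first by rewrite subrr mul0r add0r mul1r.
  apply: ltr_wpDr; first by rewrite mulr_ge0// ltW.
  by rewrite mulr_gt0// subr_gt0 lt_neqAle tn1.
rewrite ler_pdivlMr// ler_pdivrMr//.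
have h1 : 0 <= (1 - t) * u * (v - a) by rewrite !mulr_ge0 ?subr_ge0 ?(ltW u0).
have h2 : 0 <= t * v * (u - a) by rewrite !mulr_ge0 ?subr_ge0 ?(ltW v0).
have h3 : 0 <= (1 - t) * u * (b - v) by rewrite !mulr_ge0 ?subr_ge0 ?(ltW u0).
have h4 : 0 <= t * v * (b - u) by rewrite !mulr_ge0 ?subr_ge0 ?(ltW v0).
by apply/andP; split; lra.
Qed.

(** A primitive of [c0 + c1 * t], where the weight [t] of [x] is given by
    [x = u * v / (u + t * (v - u))]: it is [0] at [v] and [1] at [u]. *)
Definition affine_primitive (R : realType) (u v c0 c1 x : R) : R :=
  c0 * x + c1 / (v - u) * (u * v * ln x - u * x).

Definition affine_primitive2 (R : realType) (u v c0 c1 x : R) : R :=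
  c0 * ln x - c1 / (v - u) * (u * v * ((ln x + 1) / x) + u * ln x).

Lemma is_derive_affine_primitive (R : realType) (u v c0 c1 x : R) : 0 < x ->
  is_derive x 1 (affine_primitive R u v c0 c1)
    (c0 + c1 * ((u * v / x - u) / (v - u))).
Proof.
move=> x0; have ? := is_derive1_ln x0.
rewrite /affine_primitive.
apply: is_derive_eq; rewrite /GRing.scale/=.
ring.
Qed.

Lemma is_derive_affine_primitive2 (R : realType) (u v c0 c1 x : R) : 0 < x ->
  is_derive x 1 (affine_primitive2 R u v c0 c1)
    (affine_primitive R u v c0 c1 x / x ^+ 2).
Proof.
move=> x0; have ? := is_derive1_ln x0.
have xn0 : x != 0 by rewrite gt_eqF.
have ? : is_derive x 1 (fun y : R => y^-1) (- x ^- 2 *: 1).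
  exact: is_deriveV.
rewrite /affine_primitive2 /affine_primitive.
apply: is_derive_eq; rewrite /GRing.scale/=.
set L := ln x.
(* For [u = v] the convention [0^-1 = 0] removes every term in [c1]. *)
have [->|uv] := eqVneq (v - u) 0; first by rewrite invr0; field.
field.
by rewrite xn0.
Qed.

(** The points [v], [y], [h] have weights [0], [lam / 2], [1 / 2]. For [0 <= lam <= 1], integration
    by parts turns the left-hand side into [(v - u) ^+ 2 / 2] times the integral of [|lam - 2 * t| *
    (c0 + c1 * t) / (u + t * (v - u)) ^+ 2] over [0 <= t <= 1 / 2]; [C1] and [C2] are the closed
    forms of its two moments. *)
Lemma affine_primitive_increment (R : realType) (u v c0 c1 lam : R)
    (w := 2 * u + lam * (v - u)) (s := u + v) :
  0 < u -> 0 < v -> u != v -> 0 < w ->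
  let G := affine_primitive R u v c0 c1 in
  let P := affine_primitive2 R u v c0 c1 in
  let y := 2 * u * v / w in let h := 2 * u * v / s in
  (P y - P v + G v * (y^-1 - v^-1)) + (P y - P h + G h * (y^-1 - h^-1))
  = (v - u) ^+ 2 / 2 * (c0 * C1 lam u v + c1 * C2 lam u v).
Proof.
move=> u0 v0 uv w0 G P y h.
have s0 : 0 < s by rewrite addr_gt0.
have lnh z : 0 < z -> ln (2 * u * v / z) = ln 2 + ln u + ln v - ln z.
  by move=> z0; rewrite ln_div ?lnM ?posrE ?mulr_gt0.
have lnw : ln (w ^+ 2) = 2 * ln w.
  by rewrite expr2 lnM ?posrE//; ring.
have ln1 : ln (2 * u * s / w ^+ 2) = ln 2 + ln u + ln s - 2 * ln w.
  by rewrite ln_div ?posrE ?exprn_gt0 ?mulr_gt0// lnw !lnM ?posrE ?mulr_gt0.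
have ln2 : ln ((lam * (v - u) + 2 * u) ^+ 2 / (2 * u * s)) =
    2 * ln w - (ln 2 + ln u + ln s).
  rewrite [lam * _ + _]addrC -/w.
  by rewrite ln_div ?posrE ?exprn_gt0 ?mulr_gt0// lnw !lnM ?posrE ?mulr_gt0.
rewrite /G /P /affine_primitive /affine_primitive2 /C1 /C2 -/s -/w ln1 ln2.
rewrite {}/y {}/h !lnh//.
move: (gt_eqF w0) (gt_eqF s0).
(* With the logarithms as free variables, what remains is an identity of rational functions. *)
move: {lnh lnw ln1 ln2 w0 s0} (ln w) (ln s) => lw ls; rewrite /w /s => w0 s0.
field.
have -> : v - u != 0 by rewrite subr_eq0 eq_sym.
by rewrite (gt_eqF u0) (gt_eqF v0) s0 w0.
Qed.

(* Taking (u, v) = (a, b) gives the half of the functional supported on [H, b],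
   and (u, v) = (b, a) the half supported on [a, H]. *)
Lemma half_estimate (R : realType) (f df F : R -> R) (a b u v c0 c1 lam : R) :
  0 < a ->
  {within `[a, b], continuous f} -> {within `[a, b], continuous F} ->
  (forall x : R, x \in `]a, b[ -> is_derive x 1 f (df x)) ->
  (forall x : R, x \in `]a, b[ -> is_derive x 1 F (f x / x ^+ 2)) ->
  u \in `[a, b] -> v \in `[a, b] -> u != v -> 0 <= lam <= 1 ->
  (forall x : R, x \in `]a, b[ ->
    `|df x| <= c0 + c1 * ((u * v / x - u) / (v - u))) ->
  `|lam / 2 * f v + (1 - lam) / 2 * f (2 * u * v / (u + v))
    - u * v / (v - u) * (F v - F (2 * u * v / (u + v)))|
  <= u * v * `|v - u| / 2 * (c0 * C1 lam u v + c1 * C2 lam u v).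
Proof.
move=> a0 cf cF df_ dF_ uab vab uv /andP[lam0 lam1] le.
have pos (x : R) : x \in `[a, b] -> 0 < x.
  by rewrite in_itv/= => /andP[ax _]; exact: lt_le_trans ax.
have [u0 v0] := (pos _ uab, pos _ vab).
have uvn0 : v - u != 0 by rewrite subr_eq0 eq_sym.
pose w := 2 * u + lam * (v - u).
have w0 : 0 < w.
  rewrite /w (_ : _ + _ = (1 - lam) * u + (u + lam * v)); last by ring.
  by rewrite ltr_wpDl ?mulr_ge0 ?subr_ge0 ?(ltW u0)// ltr_pwDl// mulr_ge0// ltW.
pose h := 2 * u * v / (u + v); pose y := 2 * u * v / w.
have hab : h \in `[a, b].
  rewrite (_ : h = u * v / (u + 2^-1 * (v - u))).
    by apply: weighted_harmonic_mean_itv => //; apply/andP; split; lra.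
  rewrite /h; field.
  by apply: lt0r_neq0; lra.
have yab : y \in `[a, b].
  rewrite (_ : y = u * v / (u + lam / 2 * (v - u))).
    by apply: weighted_harmonic_mean_itv => //; apply/andP; split; lra.
  have : w != 0 by rewrite gt_eqF.
  rewrite /y /w => wn0; field.
  by rewrite [u * 2]mulrC wn0.
have K e z := @weighted_increment R f df F _ _ _ a b a0 cf cF df_ dF_
  (is_derive_affine_primitive R u v c0 c1)
  (is_derive_affine_primitive2 R u v c0 c1) le e z.
have K1 := K _ _ vab yab; have K2 := K _ _ hab yab.
have {K1 K2} := lerD K1 K2.
rewrite affine_primitive_increment// -/h => K12.
(* [F y] cancels, and the coefficients of [f v] and [f h] are the differences of weights
   [lam / 2 - 0] and [1 / 2 - lam / 2]. *)
have -> : lam / 2 * f v + (1 - lam) / 2 * f h - u * v / (v - u) * (F v - F h)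
  = u * v / (v - u) * ((F y - F v + f v * (y^-1 - v^-1))
                      - (F y - F h + f h * (y^-1 - h^-1))).
  rewrite /y /h.
  move: (F _) (F (_ / (u + v))) (f (_ / (u + v))) => Fy Fh fh; rewrite /w.
  have sn0 : u + v != 0 by rewrite gt_eqF ?addr_gt0.
  have wn0 : 2 * u + lam * (v - u) != 0 by rewrite gt_eqF.
  field. by rewrite uvn0 sn0 wn0 (gt_eqF u0) (gt_eqF v0).
rewrite normrM normrM normfV (gtr0_norm (mulr_gt0 u0 v0)).
have d0 : 0 < `|v - u| by rewrite normr_gt0.
apply: (@le_trans _ _ (u * v / `|v - u| *
   ((v - u) ^+ 2 / 2 * (c0 * C1 lam u v + c1 * C2 lam u v)))).
  rewrite ler_pM2l; last by rewrite divr_gt0 ?mulr_gt0.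
  by apply: le_trans K12; exact: ler_normB.
rewrite -(real_normK (num_real (v - u))) le_eqVlt; apply/orP; left; apply/eqP.
by field; rewrite gt_eqF.
Qed.

(** * Positivity of [C1], Young's inequality and the power mean *)

Lemma ln_lt_subr1 (R : realType) (x : R) : 0 < x -> x != 1 -> ln x < x - 1.
Proof.
move=> x0 x1.
have lx : ln x != 0 by rewrite ln_eq0.
have := expR_gt1Dx lx; rewrite lnK ?posrE//; lra.
Qed.

(** Strictness is needed to divide by [C1] when minimizing over [r]. *)
Lemma C1_gt0 (R : realType) (lam u v : R) :
  0 < u -> 0 < v -> u != v -> 0 <= lam <= 1 -> 0 < C1 lam u v.
Proof.
move=> u0 v0 uv /andP[lam0 lam1].
have s0 : 0 < u + v by rewrite addr_gt0.
have uvn0 : v - u != 0 by rewrite subr_eq0 eq_sym.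
pose w := 2 * u + lam * (v - u).
have w0 : 0 < w.
  rewrite /w (_ : _ + _ = (1 - lam) * u + (u + lam * v)); last by ring.
  by rewrite ltr_wpDl ?mulr_ge0 ?subr_ge0 ?(ltW u0)// ltr_pwDl// mulr_ge0// ltW.
have lnw : ln (2 * u * (u + v) / w ^+ 2) =
    - (ln (w / (2 * u)) + ln (w / (u + v))).
  have lnw2 : ln (w ^+ 2) = 2 * ln w by rewrite expr2 lnM ?posrE//; ring.
  rewrite !ln_div ?posrE ?mulr_gt0 ?exprn_gt0// lnw2 !lnM ?posrE ?mulr_gt0//.
  ring.
(* C1 is a positive multiple of phi(w / 2u) + phi(w / (u + v)) where
   phi(x) = x - 1 - ln x >= 0 vanishes only at 1. *)
have -> : C1 lam u v = 2 / (v - u) ^+ 2 *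
    ((w / (2 * u) - 1 - ln (w / (2 * u)))
     + (w / (u + v) - 1 - ln (w / (u + v)))).
  rewrite /C1 -/w lnw [lam * _ + _]addrC -/w.
  move: (ln _) (ln (w / _)) => l1 l2.
  by field; rewrite uvn0 !gt_eqF.
rewrite mulr_gt0 ?divr_gt0 ?exprn_even_gt0//.
have phi_ge0 (x : R) : 0 < x -> 0 <= x - 1 - ln x.
  move=> x0; have [->|x1] := eqVneq x 1; first by rewrite ln1; lra.
  by have := ln_lt_subr1 _ _ x0 x1; lra.
have w1 : 0 < w / (2 * u) by rewrite divr_gt0 ?mulr_gt0.
have w2 : 0 < w / (u + v) by rewrite divr_gt0.
(* Both summands vanish only if [w = 2 * u] and [w = u + v], which would force [u = v]. *)
have [e1|n1] := eqVneq (w / (2 * u)) 1; last first.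
  by apply: ltr_pwDl; [have := ln_lt_subr1 _ _ w1 n1; lra|exact: phi_ge0].
apply: ltr_wpDl; first exact: phi_ge0.
rewrite subr_gt0; apply: ln_lt_subr1 => //.
apply: contra uv => /eqP e2.
move: e1 => /divr1_eq e1; move: e2 => /divr1_eq e2.
by apply/eqP; lra.
Qed.

(** As a function of [X = d ^ q], the right-hand side is the tangent at [X = r ^ q] to the concave
    function [X ^ (1 / q)]. It comes from Young's inequality for [d] and [r ^ (q - 1)], divided by
    the latter. *)
Lemma young_tangent (R : realType) (d q r : R) : 0 <= d -> 1 <= q -> 0 < r ->
  d <= d `^ q / (q * r `^ (q - 1)) + (1 - 1 / q) * r.
Proof.
(* At [q = 1] there is no finite conjugate exponent, but both sides equal [d]. *)
move=> d0; rewrite le_eqVlt => /predU1P[<-|q1] r0.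
  by rewrite subrr powRr0 powRr1//; lra.
have q0 : 0 < q by lra.
have q1n0 : q - 1 != 0 by apply: lt0r_neq0; lra.
have p0 : 0 < q / (q - 1) by rewrite divr_gt0 ?subr_gt0.
have rq0 : 0 < r `^ (q - 1) by exact: powR_gt0.
have := @conjugate_powR R d (r `^ (q - 1)) q (q / (q - 1)) d0 (ltW rq0) q0 p0.
rewrite -powRrM (_ : (q - 1) * (q / (q - 1)) = q); last by field.
rewrite -(mulr_powRB1 (ltW r0) q0) => h.
rewrite -(ler_pM2r rq0); apply: le_trans (h _) _.
  by field; rewrite q1n0 gt_eqF.
rewrite le_eqVlt; apply/orP; left; apply/eqP.
move: (r `^ (q - 1)) rq0 => s s0.
by field; rewrite q1n0 !gt_eqF.
Qed.

(** At [r ^ q = N / C] the bracket collapses to [r * C], which is the product of powers in the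
    conclusion. *)
Lemma power_mean_bound (R : realType) (q S K C N : R) :
  1 <= q -> 0 <= K -> 0 < C -> 0 <= N ->
  (forall r, 0 < r ->
    S <= K * (N / (q * r `^ (q - 1)) + (1 - 1 / q) * r * C)) ->
  S <= K * (C `^ (1 - 1 / q) * N `^ (1 / q)).
Proof.
move=> q1 K0 C0; have q0 : 0 < q by lra.
have iq1 : 0 <= 1 - 1 / q by rewrite subr_ge0 ler_pdivrMr// mul1r.
rewrite le_eqVlt => /predU1P[<-|N0] h.
  rewrite powR0 ?mulr0; last by rewrite div1r invr_eq0 gt_eqF.
  (* For [N = 0] the infimum is approached only as [r] tends to [0]. If [S > 0], the choice
     [r = S / (D + 1)] gives [S <= S * D / (D + 1) < S]. *)
  rewrite leNgt; apply/negP => S0.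
  pose D := K * (1 - 1 / q) * C.
  have D0 : 0 <= D by rewrite !mulr_ge0// ltW.
  have D1 : 0 < D + 1 by lra.
  have := h (S / (D + 1)) (divr_gt0 S0 D1).
  rewrite mul0r add0r (_ : K * _ = S / (D + 1) * D); last by rewrite /D; ring.
  rewrite mulrAC ler_pdivlMr//; nra.
(* The minimizer of the right-hand side of [h]. *)
pose r := (N / C) `^ (1 / q).
have r0 : 0 < r by rewrite powR_gt0// divr_gt0.
have rq : r `^ q = N / C.
  rewrite /r -powRrM divfK ?gt_eqF// powRr1// ltW// divr_gt0//.
apply: (le_trans (h _ r0)); apply: ler_wpM2l => //.
have rq1 : 0 < r `^ (q - 1) by exact: powR_gt0.
have NE : N = r * r `^ (q - 1) * C.
  by rewrite mulr_powRB1 ?(ltW r0)// rq divfK ?gt_eqF.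
have -> : C `^ (1 - 1 / q) * N `^ (1 / q) = r * C.
  have -> : N = N / C * C by rewrite divfK ?gt_eqF.
  rewrite powRM ?(ltW C0) ?divr_ge0 ?(ltW C0) ?(ltW N0)// -/r mulrCA -powRD.
    by rewrite subrK powRr1// ltW.
  by rewrite (gt_eqF C0) implybT.
rewrite {1}NE le_eqVlt; apply/orP; left; apply/eqP.
move: (r `^ (q - 1)) rq1 => s s0.
by field; rewrite !gt_eqF.
Qed.

(** Through [young_tangent], the hypothesis bounds [|df x|] by an affine function of [t] for each
    [r]. The estimate for that function is exactly the one required by [power_mean_bound], with
    [C = C1] and [N = C2 * gu + C3 * gv]. *)
Lemma half_power_estimate (R : realType) (f df F : R -> R)
    (a b u v gu gv lam q : R) :
  0 < a -> 1 <= q ->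
  {within `[a, b], continuous f} -> {within `[a, b], continuous F} ->
  (forall x : R, x \in `]a, b[ -> is_derive x 1 f (df x)) ->
  (forall x : R, x \in `]a, b[ -> is_derive x 1 F (f x / x ^+ 2)) ->
  u \in `[a, b] -> v \in `[a, b] -> u != v -> 0 <= lam <= 1 ->
  (forall x : R, x \in `]a, b[ ->
    let t := (u * v / x - u) / (v - u) in
    `|df x| `^ q <= t * gu + (1 - t) * gv) ->
  `|lam / 2 * f v + (1 - lam) / 2 * f (2 * u * v / (u + v))
    - u * v / (v - u) * (F v - F (2 * u * v / (u + v)))|
  <= u * v * `|v - u| / 2 * (C1 lam u v `^ (1 - 1 / q)
       * (C2 lam u v * gu + C3 lam u v * gv) `^ (1 / q)).
Proof.
move=> a0 q1 cf cF df_ dF_ uab vab uv lam01 le.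
have pos (x : R) : x \in `[a, b] -> 0 < x.
  by rewrite in_itv/= => /andP[ax _]; exact: lt_le_trans ax.
have [u0 v0] := (pos _ uab, pos _ vab).
have q0 : 0 < q by lra.
have K0 : 0 < u * v * `|v - u| / 2.
  by rewrite divr_gt0// !mulr_gt0// normr_gt0 subr_eq0 eq_sym.
have NE : C2 lam u v * gu + C3 lam u v * gv
    = gv * C1 lam u v + (gu - gv) * C2 lam u v by rewrite /C3; ring.
apply: power_mean_bound => //.
- exact: ltW.
- exact: C1_gt0.
- have c0 : {within `[a, b], continuous (cst 0 : R -> R)}.
    by apply: continuous_subspaceT => x; exact: cvg_cst.
  have d0 (x : R) : x \in `]a, b[ -> is_derive x 1 (cst 0 : R -> R) 0.
    by move=> _; exact: is_derive_cst.
  (* N >= 0 is the estimate for the zero function. *)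
  have := @half_estimate R (cst 0) (cst 0) (cst 0) a b u v gv (gu - gv) lam a0
    c0 c0 d0 _ uab vab uv lam01 _.
  rewrite NE => h; rewrite -(pmulr_rge0 _ K0); apply: le_trans (h _ _) => //.
    by move=> x xab /=; rewrite mul0r; exact: d0.
  move=> x xab /=; rewrite normr0.
  have := le_trans (powR_ge0 _ _) (le _ xab); move: (_ / (v - u)) => t /=; lra.
move=> r r0.
have rq0 : 0 < r `^ (q - 1) by exact: powR_gt0.
have h := @half_estimate R f df F a b u v
  (gv / (q * r `^ (q - 1)) + (1 - 1 / q) * r)
  ((gu - gv) / (q * r `^ (q - 1))) lam a0 cf cF df_ dF_ uab vab uv lam01 _.
rewrite NE; apply: le_trans (h _) _.
  move=> x xab; have := le _ xab; move: (_ / (v - u)) => t /= {}le.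
  apply: le_trans (young_tangent _ _ _ _ (normr_ge0 _) q1 r0) _.
  rewrite addrAC lerD2r [_ / _ * t]mulrAC -mulrDl.
  rewrite ler_pM2r; last by rewrite invr_gt0 mulr_gt0.
  by move: le; lra.
rewrite le_eqVlt; apply/orP; left; apply/eqP; congr (_ * _).
ring.
Qed.

(** * Relative derivatives and the primitive of a continuous function *)

Lemma cvg_derivable_rel (R : realType) (J : set R) (f : R -> R) (x : R) :
  derivable_rel J f x -> f @ within J (nbhs x) --> f x.
Proof.
move=> /cvgP q.
(* At y = x the quotient is 0 / 0 = 0, so that g agrees with f there too. *)
pose g (y : R) := f x + (f y - f x) / (y - x) * (y - x).
have fE : f = g.
  apply/funext => y; rewrite /g; have [->|yx] := eqVneq y x.
    by rewrite !subrr mulr0 addr0.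
  by rewrite divfK ?subr_eq0//; ring.
have cg : f @ within J x^' --> f x.
  have idx : (y : R) @[y --> within J x^'] --> x.
    exact: cvg_trans (cvg_within _) (cvg_within _).
  have : g y @[y --> within J x^'] --> f x + derive_rel J f x * (x - x).
    by apply: cvgD; [exact: cvg_cst|apply: cvgM q (cvgB idx (cvg_cst _))].
  by rewrite subrr mulr0 addr0 -fE.
move=> U Ux; have := cg _ Ux.
rewrite /nbhs/= /within/= /dnbhs => h.
near=> y => Jy.
(* The deleted filter ignores [y = x], where [f x] lies in its own neighbourhood [U]. *)
have [->|yx] := eqVneq y x; first exact: nbhs_singleton.
move: yx Jy; near: y; exact: h.
Unshelve. all: by end_near. Qed.

(** Near an interior point the restriction to [J] is vacuous, and the substitution [h = y - x]
    matches the two difference quotients. *)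
Lemma derive_rel_interior (R : realType) (J : set R) (f : R -> R) (x : R) :
  J° x -> derivable f x 1 -> is_derive x 1 f (derive_rel J f x).
Proof.
move=> Jx fx.
have wE : within J x^' = x^'.
  apply/predeqP => B; split => h; last by apply: filterS h => y By _.
  have h2 : \forall y \near x^', J y by exact: (nbhs_dnbhs Jx).
  by move: h h2; rewrite /within/=; apply: filterS2 => y By; exact: By.
suff -> : derive_rel J f x = 'D_1 f x by exact: derivableP.
rewrite /derive_rel wE; apply/cvg_lim => //.
have df : h^-1 *: (f (h *: 1 + x) - f x) @[h --> 0^'] --> 'D_1 f x by exact: fx.
have sx : (y - x) @[y --> x^'] --> (0:R)^'.
  have s0 : (y - x) @[y --> x] --> (0 : R).
    by rewrite -(subrr x); exact: cvgB cvg_id (cvg_cst _).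
  move=> U U0.
  have h : \forall y \near x, y - x != 0 -> U (y - x) by exact: s0 _ U0.
  change (\forall y \near x, y != x -> U (y - x)).
  by apply: filterS h => y h yx; apply: h; rewrite subr_eq0.
have := cvg_comp _ _ sx df.
apply: cvg_trans; apply: near_eq_cvg; near=> y.
by rewrite /= /GRing.scale/= mulr1 subrK mulrC.
Unshelve. all: by end_near. Qed.

Lemma derivable_rel_continuous (R : realType) (J : set R) (f : R -> R)
    (a b : R) :
  `[a, b] `<=` J -> (forall x, x \in `[a, b] -> derivable_rel J f x) ->
  {within `[a, b], continuous f}.
Proof.
move=> abJ df; apply/subspace_continuousP => x xab.
apply: cvg_trans (@cvg_derivable_rel _ _ _ _ (df _ xab)).
apply: cvg_app => U.
change ((\forall y \near x, J y -> U y) ->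
  \forall y \near x, [set` `[a, b]] y -> U y).
by apply: filterS => y JU /abJ.
Qed.

Lemma primitive_of_continuous (R : realType) (g : R -> R) (a b : R) : a < b ->
  {within `[a, b], continuous g} ->
  let F x := (\int[@lebesgue_measure R]_(t in `[a, x]) g t)%R in
  [/\ {within `[a, b], continuous F}, F a = 0 &
      forall x : R, x \in `]a, b[ -> is_derive x 1 F (g x)].
Proof.
move=> ab cg F.
have ig : (@lebesgue_measure R).-integrable `[a, b] (EFin \o g).
  by apply: continuous_compact_integrable => //; exact: segment_compact.
split.
- exact: (parameterized_integral_continuous (ltW ab) ig).
- by rewrite /F set_itv1 Rintegral_set1.
- move=> x xab.
  have cx : {for x, continuous g}.
    by move/(continuous_within_itvP _ ab) : cg => [+ _ _]; exact.
  move: xab; rewrite in_itv/= => /andP[ax xb].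
  have [dF F'] := continuous_FTC1_closed xb ig ax cx.
  by rewrite -F' derive1E; exact: derivableP.
Qed.

(** * Assembly of the two halves *)

Theorem theorem5 (R : realType) (I : set R) (f : R -> R) (a b q : R)
  (I_itv : is_interval I)
  (I_pos : I `<=` [set x | 0 < x])
  (f_diff : forall x, I° x -> derivable f x 1)
  (Ia : I a) (Ib : I b) (ab : a < b)
  (f_diff_ab : forall x, x \in `[a, b] -> derivable_rel I f x)
  (f'_L : (@lebesgue_measure R).-integrable `[a, b] (EFin \o derive_rel I f))
  (q_ge1 : 1 <= q)
  (f'_hconv : harmonically_convex `[a, b] (fun x => `|derive_rel I f x| `^ q))
  (lam : R) (lam01 : 0 <= lam <= 1) :
  `| (1 - lam) * f (2 * a * b / (a + b)) + lam * ((f a + f b) / 2)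
     - a * b / (b - a)
       * \int[@lebesgue_measure R]_(x in `[a, b]) (f x / x ^+ 2) |
  <= a * b * (b - a) / 2 *
     ( C1 lam a b `^ (1 - 1 / q)
         * (C2 lam a b * `|derive_rel I f a| `^ q
            + C3 lam a b * `|derive_rel I f b| `^ q) `^ (1 / q)
     + C1 lam b a `^ (1 - 1 / q)
         * (C3 lam b a * `|derive_rel I f a| `^ q
            + C2 lam b a * `|derive_rel I f b| `^ q) `^ (1 / q) ).

Proof.
have abI : `[a, b] `<=` I.
  by move=> x /=; rewrite in_itv/=; exact: I_itv.
have a0 : 0 < a by exact: I_pos.
have b0 : 0 < b by exact: I_pos.
have dfI (x : R) : x \in `]a, b[ -> is_derive x 1 f (derive_rel I f x).
  move=> xab.
  have Ix : I° x.
    apply: filterS (near_in_itvoo xab) => y yab.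
    exact/abI/subset_itv_oo_cc.
  exact: derive_rel_interior (f_diff _ Ix).
have cf := derivable_rel_continuous _ _ _ _ _ abI f_diff_ab.
have cg : {within `[a, b], continuous (fun x => f x / x ^+ 2)}.
  have cV : {within `[a, b], continuous (fun x : R => (x ^+ 2)^-1)}.
    apply: derivable_within_continuous => x; rewrite in_itv/= => /andP[ax _].
    apply: derivableV; first by rewrite expf_neq0// gt_eqF// (lt_le_trans a0).
    exact: exprn_derivable.
  by move=> x; apply: cvgM; [exact: cf|exact: cV].
pose F (x : R) : R := \int[@lebesgue_measure R]_(t in `[a, x]) (f t / t ^+ 2).
have [cF Fa dF] : [/\ {within `[a, b], continuous F}, F a = 0 &
    forall x : R, x \in `]a, b[ -> is_derive x 1 F (f x / x ^+ 2)].
  exact: primitive_of_continuous.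
have aab : a \in `[a, b] by rewrite in_itv/= lexx ltW.
have bab : b \in `[a, b] by rewrite in_itv/= lexx ltW.
have hconv (x : R) : x \in `]a, b[ -> let t := (a * b / x - a) / (b - a) in
    `|derive_rel I f x| `^ q <=
    t * `|derive_rel I f a| `^ q + (1 - t) * `|derive_rel I f b| `^ q.
  rewrite in_itv/= => /andP[ax xb].
  have x0 : 0 < x by exact: lt_trans ax.
  have d0 : 0 < b - a by rewrite subr_gt0.
  set t := _ / _.
  have t01 : 0 <= t <= 1.
    rewrite /t divr_ge0 ?(ltW d0)//=; last first.
      by rewrite subr_ge0 ler_pdivlMr// ler_pM2l// ltW.
    by rewrite ler_pdivrMr// mul1r lerB// ler_pdivrMr// mulrC ler_pM2l// ltW.
  (* Taking the points in the order [b], [a] puts the weight [t] on the value at [a]. *)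
  have [_ _ /(_ b a t bab aab t01)] := f'_hconv.
  rewrite (_ : b * a / _ = x)// (_ : t * b + (1 - t) * a = a * b / x).
    by field; rewrite !gt_eqF.
  by rewrite /t; field; rewrite !gt_eqF.
have hconv' (x : R) : x \in `]a, b[ -> let t := (b * a / x - b) / (a - b) in
    `|derive_rel I f x| `^ q <=
    t * `|derive_rel I f b| `^ q + (1 - t) * `|derive_rel I f a| `^ q.
  move=> xab /=; rewrite addrC.
  (* Exchanging [a] and [b] replaces the weight [t] by [1 - t]. *)
  rewrite (_ : (b * a / x - b) / (a - b) = 1 - (a * b / x - a) / (b - a)).
    by rewrite subKr; exact: hconv.
  have xn0 : x != 0.
    move: xab; rewrite in_itv/= => /andP[ax _].
    by rewrite gt_eqF// (lt_trans a0).
  by field; rewrite xn0 !subr_eq0 (lt_eqF ab) (gt_eqF ab).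
have ab_neq : a != b by rewrite lt_eqF.
have ba_neq : b != a by rewrite gt_eqF.
have h1 := half_power_estimate _ _ _ _ _ _ _ _ _ _ _ _ a0 q_ge1 cf cF dfI dF
  aab bab ab_neq lam01 hconv.
have h2 := half_power_estimate _ _ _ _ _ _ _ _ _ _ _ _ a0 q_ge1 cf cF dfI dF
  bab aab ba_neq lam01 hconv'.
have {h1 h2} := lerD h1 h2.
rewrite (_ : 2 * b * a / (b + a) = 2 * a * b / (a + b)); last first.
  by rewrite (addrC b) [2 * b * a]mulrAC.
have nba : `|b - a| = b - a by rewrite gtr0_norm ?subr_gt0.
rewrite (distrC a b) nba Fa -/(F b).
set S1 := (X in `|X| + _ <= _); set S2 := (X in _ + `|X| <= _) => h.
(* The values of [F] at the harmonic mean cancel between the halves; as [F a = 0], only [F b], the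
   full integral, is left. *)
rewrite (_ : _ - _ = S1 + S2); last first.
  rewrite /S1 /S2; move: (F b) (F _) (f (_ / _)) => Fb Fh fh.
  by field; rewrite !subr_eq0 (lt_eqF ab) (gt_eqF ab).
apply: le_trans (ler_normD _ _) (le_trans h _).
rewrite (mulrC b a) -mulrDr le_eqVlt; apply/orP; left; apply/eqP.
refine (congr1 (fun z => _ * (_ + _ * z `^ (1 / q))) (addrC _ _)).
Qed.
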